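(* Let $\|\cdot\|$ be an arbitrary norm on $\mathbb{R}^2$, and let $M_{\|\cdot\|}=\left(\frac{4ac}{4D^2-1}\right)^{1/4}$, where $a,c,D$ are the parameters of a best ellipsoid norm for $\|\cdot\|$. Then for all $r\in[0,M_{\|\cdot\|}^{2/3}]$ there exist continuum many lattices $L\in\mathbb{X}_3$ such that $$r=\min\{\,\varepsilon>0\;:\; g_tL\notin\mathbb{K}_\varepsilon^{\|\cdot\|^*}\text{ for all } t \text{ large enough}\,\}.$$
   Context: $\|\cdot\|_@$ is a best ellipsoid norm for $\|\cdot\|$ with parameters $a,c>0$, $D\ge1$ if for all $\vec u=(u_1,u_2)\in\mathbb{R}^2$ it satisfies $\|\vec u\|_@:=\sqrt{au_1^2+cu_2^2}\le\|\vec u\|\le D\sqrt{au_1^2+cu_2^2}=D\|\vec u\|_@$, and if it maximises the value $\left(\frac{4ac}{4D^2-1}\right)^{1/4}$ (among all $a,c>0$, $D\ge1$ satisfying these inequalities). $\mathbb{X}_3$ is the space of lattices in $\mathbb{R}^3$ of covolume $1$. The norm $\|\cdot\|^*$ on $\mathbb{R}^3$ is $\|(\vec x,z)\|^*=\max\{\|\vec x\|,|z|\}$ for $\vec x\in\mathbb{R}^2$, $z\in\mathbb{R}$. For $L\in\mathbb{X}_3$, $\lambda_1(L,\|\cdot\|^* )=\min\{\|\vec u\|^*:\vec0\ne\vec u\in L\}$. For $\varepsilon>0$, $\mathbb{K}_\varepsilon^{\|\cdot\|^*}=\{L\in\mathbb{X}_3:\varepsilon\le\lambda_1(L,\|\cdot\|^*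 )\}$. For $t\ge0$, $g_t=\mathrm{diag}(e^t,e^t,e^{-2t})$.
   Formalization: For r = 0 the minimum over ε > 0 can never equal 0, so there the condition is read as: every ε > 0 belongs to the set (its infimum is 0); for r > 0 the minimum is literal. *)

(* Defs.v *)
From HB Require Import structures.
From mathcomp Require Import all_boot all_order all_algebra.
From mathcomp Require Import all_classical all_reals all_analysis.
Set Implicit Arguments.
Unset Strict Implicit.
Unset Printing Implicit Defensive.
Import Order.TTheory GRing.Theory Num.Theory.
Import numFieldNormedType.Exports.
Local Open Scope classical_set_scope.
Local Open Scope ring_scope.

(* A norm is an arbitrary function on 'cV[R]_2, not the canonical (sup) norm
   that the library attaches to matrices; nonnegativity follows from the three
   axioms. *)
Record is_norm (R : realType) (V : lmodType R) (N : V -> R) : Prop := IsNorm {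
  norm_triangle : forall u v : V, N (u + v) <= N u + N v;
  norm_homogeneous : forall (k : R) (u : V), N (k *: u) = `|k| * N u;
  norm_definite : forall u : V, N u = 0 -> u = 0 }.

Section BestEllipsoid.
Context {R : realType}.
Implicit Types (N : 'cV[R]_2 -> R) (a c D : R).

Definition ellipsoid_norm a c (u : 'cV[R]_2) : R :=
  Num.sqrt (a * u 0 0 ^+ 2 + c * u 1 0 ^+ 2).

Definition ellipsoid_bound N a c D : Prop :=
  [/\ 0 < a, 0 < c, 1 <= D &
      forall u, ellipsoid_norm a c u <= N u <= D * ellipsoid_norm a c u].

Definition ellipsoid_value a c D : R :=
  (4 * a * c / (4 * D ^+ 2 - 1)) `^ (1 / 4).

Definition best_ellipsoid N a c D : Prop :=
  ellipsoid_bound N a c D /\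
  forall a' c' D', ellipsoid_bound N a' c' D' ->
    ellipsoid_value a' c' D' <= ellipsoid_value a c D.

End BestEllipsoid.

Section Lattices.
Context {R : realType}.
Implicit Types (N : 'cV[R]_2 -> R) (L : set 'cV[R]_3).

Definition lattice_of (A : 'M[R]_3) : set 'cV[R]_3 :=
  [set A *m map_mx intr z | z in [set: 'cV[int]_3]].

Definition X3 : set (set 'cV[R]_3) :=
  [set L | exists2 A : 'M[R]_3, `|\det A| = 1 & L = lattice_of A].

Definition norm_star N (u : 'cV[R]_3) : R :=
  Num.max (N (usubmx (u : 'cV[R]_(2 + 1)))) `|u ord_max 0|.

(* On a lattice this infimum is attained, by discreteness. *)
Definition lambda1 N L : R := inf (norm_star N @` (L `\ 0)).

Definition K_ N (e : R) : set (set 'cV[R]_3) :=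
  [set L | X3 L /\ e <= lambda1 N L].

Definition g_ (t : R) : 'M[R]_3 :=
  diag_mx (\row_(j < 3) if (j < 2)%N then expR t else expR (- 2 * t)).

Definition g_act (t : R) L : set 'cV[R]_3 := mulmx (g_ t) @` L.

Definition escape_levels N L : set R :=
  [set e | 0 < e /\ \forall t \near +oo, ~ K_ N e (g_act t L)].

End Lattices.

(* [r] is the least element of a set [S] of positive reals. A set of positive
   reals cannot have 0 as least element; by convention its minimum is 0 when
   every positive real belongs to it (for the sets [escape_levels], which are
   upward closed, this says that their infimum is 0). *)
Definition is_min_pos (R : realType) (S : set R) (r : R) : Prop :=
  (S r /\ lbound S r) \/ (r = 0 /\ S = [set e | 0 < e]).

(* Main.v *)
(** For theta in R^2 put x(z) = (z_1, z_2) + z_3 theta for integer vectors z,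
    and let L_(theta,w) be the lattice of all (x(z), z_3 + w x(z)_1). The
    shear by w is contracted by g_t, so it does not affect the asymptotics,
    and distinct w give distinct lattices: one good theta yields continuum
    many lattices.

    If v_k are the best approximations to theta, with heights q_k, the local
    maxima of t |-> lambda_1(g_t L)^3 are the numbers q_(k+1) |x(v_k)|^2, so
    these have to tend to r^3 from below. Choose v_(k+1) = v_(k-2) + m v_(k-1)
    + n v_k with m large and n of order m^2. The freedom in n allows one to
    prescribe both the size of q_(k+1) |x(v_k)|^2 and the position of x(v_(k-1))
    modulo x(v_k): in the inner product of the ellipsoid it is put halfway.
    In the planar lattice spanned by x(v_(k-1)) and x(v_k), of covolume
    1 / q_(k+1), the vector x(v_k) is then almost shortest as soon as
    r^6 (4 D^2 - 1) <= 4 a c, which is the hypothesis on r. All conditions are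
    stable under small perturbations of theta, which is obtained as the
    intersection of nested boxes. For r = 0, lattices containing a vertical
    vector suffice. *)

Require Import Defs.
From HB Require Import structures.
From mathcomp Require Import all_boot all_order all_algebra.
From mathcomp Require Import all_classical all_reals all_analysis.
From mathcomp Require Import ring lra zify.
Import Order.TTheory GRing.Theory Num.Theory.
Import numFieldNormedType.Exports.
Local Open Scope classical_set_scope.
Local Open Scope ring_scope.

(** * Elementary estimates and nested intervals *)

Lemma sqrz_eq1_or_ge4 (m : int) : m != 0 -> m ^+ 2 = 1 \/ 4 <= m ^+ 2.
Proof.
move=> m0; have [?|?] : `|m|%N = 1%N \/ (2 <= `|m|)%N by lia.
  by left; have [->|->] : m = 1 \/ m = -1 by lia.
by right; nia.
Qed.

Lemma normr_intr_ge1 (R : realType) (k : int) : k != 0 -> 1 <= `|k%:~R : R|.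
Proof. by move=> k0; rewrite -intr_norm (@ler_int R 1); lia. Qed.

Lemma intr_le_opp1 (R : realType) (k : int) : k < 0 -> (k%:~R : R) <= -1.
Proof. by move=> k0; rewrite -(@intrN R 1) ler_int; lia. Qed.

(** Up to an error [kappa S], [P + j S] is a half-odd multiple of [S], so its absolute value is at
    least [(1/2 - kappa) S]. For [kappa >= 1/2] the bound is negative. *)
Lemma half_int_dist {R : realType} (P S kappa : R) (n j : int) : 0 < S -> 0 <= kappa ->
  `|P - (n%:~R + 1 / 2) * S| <= kappa * S ->
  (1 / 4 - kappa) * S ^+ 2 <= (P + j%:~R * S) ^+ 2.
Proof.
move=> S0 k0; rewrite ler_norml => /andP[h1 h2].
have [k2|k2] := lerP (1/2) kappa.
  apply: (@le_trans _ _ 0); last exact: sqr_ge0.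
  by rewrite pmulr_lle0 ?exprn_gt0//; lra.
have hS : ((1/2 - kappa) * S) ^+ 2 <= (P + j%:~R * S) ^+ 2.
  have [nj|nj] := lerP 0 (n + j).
    have hn : 0 <= (n%:~R + j%:~R : R) by rewrite -intrD ler0z.
    have hnS : 0 <= (n%:~R + j%:~R) * S by rewrite mulr_ge0// ltW.
    rewrite ler_sqr ?nnegrE; nra.
  have hn : (n%:~R + j%:~R : R) <= -1.
    by rewrite -intrD intr_le_opp1.
  have hnS : (n%:~R + j%:~R + 1) * S <= 0 by rewrite pmulr_lle0//; lra.
  rewrite -[leRHS]sqrrN ler_sqr ?nnegrE; nra.
apply: le_trans hS; rewrite exprMn ler_wpM2r ?sqr_ge0//; nra.
Qed.

(** Raising [b] by one moves [c0 - s b] by [s], so it comes within [s] of a half-integer during one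
    period [1/s] beyond [B], up to rounding. *)
Lemma int_near_half {R : realType} (s c0 B : R) : 0 < s ->
  exists b n : int, [/\ B <= b%:~R, b%:~R <= B + s^-1 + 1 &
    `|c0 - s * b%:~R - (n%:~R + 1 / 2)| <= s].
Proof.
move=> s0; pose m := Num.floor (c0 - s * B - 1 / 2).
have /andP[m1 m2] := floor_itv (c0 - s * B - 1 / 2); rewrite -/m intrD in m1 m2.
pose t := (c0 - m%:~R - 1 / 2) / s.
have ts : s * t = c0 - m%:~R - 1 / 2 by rewrite mulrC divfK ?gt_eqF.
have := ceil_itv t; set b := Num.ceil t => /andP[]; rewrite intrB => b1 b2.
exists b, m; split.
- by apply: le_trans b2; rewrite -(ler_pM2l s0); lra.
- have : t <= B + s^-1 by rewrite -(ler_pM2l s0) mulrDr mulfV ?gt_eqF//; lra.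
  by lra.
rewrite ler_norml; apply/andP; split; nra.
Qed.

(** In the application [al], [be], [ga] are the Gram entries [<x1,x1>], [<x0,x1>], [<x0,x0>], with
    [V = <x1, x0 + a x1>] and [W = |x0 + a x1|^2]; the last hypothesis is Cauchy-Schwarz. For large
    [a] the terms in [al] dominate. *)
Lemma quadratic_growth {R : realType} (al be ga a V W : R) :
  1 <= a -> 0 < al -> 2 * `|be| <= a * al -> ga <= a * al ->
  V = be + a * al -> W = ga + 2 * a * be + a ^+ 2 * al -> V ^+ 2 <= al * W ->
  [/\ 0 < V, 0 < W, V / W <= 2 / a, W / V <= 6 * a & a ^+ 2 * al <= 4 * W].
Proof.
move=> a1 al0 hbe hga VE WE VW.
have a0 : 0 < a := lt_le_trans ltr01 a1.
have aal : 0 < a * al by rewrite mulr_gt0.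
have [be1 be2] : - `|be| <= be /\ be <= `|be| by rewrite ler_norm lerNl -normrN ler_norm.
have V2 : a * al <= 2 * V by lra.
have V0 : 0 < V by lra.
have W0 : 0 < W.
  by rewrite -(pmulr_rgt0 _ al0); apply: lt_le_trans VW; rewrite exprn_gt0.
split=> //.
- rewrite ler_pdivrMr// -(ler_pM2r V0) -expr2; apply: (le_trans VW).
  rewrite (_ : _ * W * V = 2 * V / a * W); last by ring.
  by rewrite ler_pM2r// ler_pdivlMr// mulrC.
- rewrite ler_pdivrMr//.
  have : a * (2 * be) <= a * (a * al) by rewrite ler_pM2l//; lra.
  have : a * (a * al) <= a * (2 * V) by rewrite ler_pM2l.
  have : a * al <= a * (a * al) by rewrite ler_peMl// ltW.
  by rewrite WE expr2; lra.
- rewrite -(ler_pM2r al0).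
  have : (a * al) ^+ 2 <= (2 * V) ^+ 2 by rewrite ler_sqr ?nnegrE; lra.
  by rewrite !exprMn; lra.
Qed.

Lemma cube_root {R : realType} (x : R) : 0 < x -> exists2 E : R, 0 < E & E ^+ 3 = x.
Proof.
move=> x0; exists (x `^ 3^-1); first exact: powR_gt0.
by rewrite -powR_mulrn ?powR_ge0// -powRrM mulVf ?powRr1 ?ltW.
Qed.

(** At the expansion factor [E] the stretched length [E n] equals the contracted height [q / E^2];
    both are the cube root of [q n^2]. The lower bound uses [(1 - kap)^3 <= 1 - kap]. *)
Lemma time_scale {R : realType} (q n kap r : R) : 0 < q -> 0 < n -> 0 < kap <= 1 -> 0 < r ->
  (1 - kap) * r ^+ 3 <= q * n ^+ 2 -> q * n ^+ 2 <= r ^+ 3 ->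
  exists E, [/\ 0 < E, E ^+ 2 * (E * n) = q, E * n <= r & (1 - kap) * r <= E * n].
Proof.
move=> q0 n0 /andP[k0 k1] r0 low up.
have [E E0 E3] := cube_root (q / n) (divr_gt0 q0 n0).
have En0 : 0 < E * n by rewrite mulr_gt0.
have En3 : (E * n) ^+ 3 = q * n ^+ 2 by rewrite exprMn E3; field; rewrite gt_eqF.
exists E; split=> //; first by rewrite mulrA -exprSr E3 divfK// gt_eqF.
  by rewrite -(@ler_pXn2r _ 3) ?nnegrE ?(ltW En0) ?(ltW r0)// En3.
have k1' : 0 <= 1 - kap by rewrite subr_ge0.
rewrite -(@ler_pXn2r _ 3) ?nnegrE ?(ltW En0)//; last exact: mulr_ge0 k1' (ltW r0).
rewrite En3 exprMn; apply: le_trans low; rewrite ler_pM2r ?exprn_gt0//.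
by rewrite exprS ler_piMr// expr_le1// gerBl ltW.
Qed.

Lemma sqr_close {R : realType} (n h : R) : 0 <= n -> 0 < h ->
  exists2 e, 0 < e & (n + e) ^+ 2 < n ^+ 2 + h.
Proof.
move=> n0 h0; have d0 : 0 < 2 * n + 1 + h by lra.
exists (h / (2 * n + 1 + h)); first exact: divr_gt0.
set e := h / _; have e0 : 0 < e by exact: divr_gt0.
have eE : e * (2 * n + 1 + h) = h by rewrite /e divfK ?gt_eqF.
have e1 : e < 1 by rewrite /e ltr_pdivrMr//; lra.
by nra.
Qed.

Lemma nested_intervals (R : realType) (c d : nat -> R) :
  (forall k, 0 <= d k) ->
  (forall k, c k - d k <= c k.+1 - d k.+1) ->
  (forall k, c k.+1 + d k.+1 <= c k + d k) ->
  exists t, forall k, `|t - c k| <= d k.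
Proof.
move=> d0 lo hi.
have lom i j : (i <= j)%N -> c i - d i <= c j - d j.
  by move/subnK => <-; elim: (j - i)%N => // k IH; exact: le_trans IH (lo _).
have him i j : (i <= j)%N -> c j + d j <= c i + d i.
  by move/subnK => <-; elim: (j - i)%N => // k IH; exact: le_trans (hi _) IH.
have lohi i j : c i - d i <= c j + d j.
  have := lom i _ (leq_maxl i j); have := him j _ (leq_maxr i j).
  by have := d0 (maxn i j); lra.
exists (sup (range (fun k => c k - d k))) => k.
have h1 : c k - d k <= sup (range (fun k => c k - d k)).
  apply: ub_le_sup; last by exists k.
  by exists (c k + d k) => _ [i _ <-]; exact: lohi.
have h2 : sup (range (fun k => c k - d k)) <= c k + d k.
  apply: ge_sup; first by exists (c k - d k); exists k.
  by move=> _ [i _ <-]; exact: lohi.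
by rewrite ler_norml; apply/andP; split; lra.
Qed.

(** * Choosing the next approximation vector *)

Section PlaneNorm.
Context {R : realType} (nrm : R -> R -> R) (A C D rho : R).
Hypothesis nrmD : forall x y x' y', nrm (x + x') (y + y') <= nrm x y + nrm x' y'.
Hypothesis nrmZ : forall k x y, nrm (k * x) (k * y) = `|k| * nrm x y.
Hypothesis nrm_ge0 : forall x y, 0 <= nrm x y.
Hypothesis A_gt0 : 0 < A.
Hypothesis C_gt0 : 0 < C.
Hypothesis nrm_lb : forall x y, A * x ^+ 2 + C * y ^+ 2 <= nrm x y ^+ 2.
Hypothesis nrm_ub : forall x y, nrm x y ^+ 2 <= D ^+ 2 * (A * x ^+ 2 + C * y ^+ 2).
Hypothesis rho_gt0 : 0 < rho.
Hypothesis rho_le : rho ^+ 2 * (4 * D ^+ 2 - 1) <= 4 * A * C.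

(** The vectors [(x', y')] and [(x, y)] span a planar lattice of covolume [1/q]. In the ellipsoid
    inner product, split a lattice vector along and across [(x, y)]: the halfway position of
    [(x', y')] bounds the first component from below, the covolume the second. *)
Lemma short_vector_dominates (x y x' y' q kappa : R) (n : int) :
  0 < q -> (q * (x' * y - y' * x)) ^+ 2 = 1 ->
  q * nrm x y ^+ 2 <= rho -> 0 <= kappa <= 1 ->
  `|(A * x' * x + C * y' * y) - (n%:~R + 1 / 2) * (A * x ^+ 2 + C * y ^+ 2)|
    <= kappa * (A * x ^+ 2 + C * y ^+ 2) ->
  forall m k : int, (m != 0) || (k != 0) ->
  (1 - kappa) * nrm x y ^+ 2 <=
    nrm (m%:~R * x' + k%:~R * x) (m%:~R * y' + k%:~R * y) ^+ 2.
Proof.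
move=> q0 det1 hrho /andP[k0 k1] hP m k mk.
have [m0|m0] := eqVneq m 0.
  move: mk; rewrite m0 eqxx /= => kn0; rewrite mul0r mul0r !add0r nrmZ exprMn.
  rewrite ler_wpM2r ?sqr_ge0//.
  have := normr_intr_ge1 R k kn0.
  nra.
set N2 := nrm x y ^+ 2 in hrho *.
set S := A * x ^+ 2 + C * y ^+ 2 in hP *.
set P := A * x' * x + C * y' * y in hP *.
set d := x' * y - y' * x in det1.
have S_gt0 : 0 < S.
  have : 0 <= S by rewrite addr_ge0// mulr_ge0 ?sqr_ge0// ltW.
  rewrite le_eqVlt => /orP[/eqP S0|//].
  have /eqP : A * x ^+ 2 = 0.
    apply/eqP; rewrite eq_le mulr_ge0 ?sqr_ge0 ?(ltW A_gt0)// andbT.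
    have : 0 <= C * y ^+ 2 by rewrite mulr_ge0 ?sqr_ge0// ltW.
    by move: S0; rewrite /S; lra.
  rewrite mulf_eq0 (gt_eqF A_gt0) /= sqrf_eq0 => /eqP x0.
  have /eqP : C * y ^+ 2 = 0 by move: S0; rewrite /S x0; lra.
  rewrite mulf_eq0 (gt_eqF C_gt0) /= sqrf_eq0 => /eqP y0.
  by move: det1; rewrite /d x0 y0 !mulr0 subr0 mulr0 expr0n => /eqP; rewrite eq_sym oner_eq0.
have SN : S <= N2 by exact: nrm_lb.
have ND : N2 <= D ^+ 2 * S by exact: nrm_ub.
apply: le_trans (nrm_lb _ _).
set U := (X in _ <= X).
(* Lagrange's identity; the second summand is the transverse part. *)
have US : U * S = (m%:~R * P + k%:~R * S) ^+ 2 + A * C * (m%:~R ^+ 2 * d ^+ 2).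
  by rewrite /U /S /P /d; ring.
have d2 : N2 ^+ 2 * (4 * D ^+ 2 - 1) <= 4 * (A * C * d ^+ 2).
  have q2 : 0 < q ^+ 2 by rewrite exprn_gt0.
  rewrite -(ler_pM2l q2).
  have -> : q ^+ 2 * (4 * (A * C * d ^+ 2)) = 4 * A * C * (q * d) ^+ 2 by ring.
  rewrite det1 mulr1; apply: le_trans rho_le.
  have -> : q ^+ 2 * (N2 ^+ 2 * (4 * D ^+ 2 - 1)) = (q * N2) ^+ 2 * (4 * D ^+ 2 - 1) by ring.
  rewrite ler_wpM2r//; first by nra.
  by rewrite ler_sqr ?nnegrE ?(ltW rho_gt0)// mulr_ge0 ?sqr_ge0// (ltW q0).
rewrite -(ler_pM2r S_gt0) US.
have N2S : S * N2 <= N2 ^+ 2 by rewrite expr2 ler_wpM2r// sqr_ge0.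
(* For [m = 1] or [-1] both parts are used; for larger [|m|] the transverse part alone suffices. *)
have [m1|m1] := sqrz_eq1_or_ge4 m m0.
  have [mR mR'] : (m%:~R ^+ 2 = 1 :> R) /\ m%:~R * P + k%:~R * S = m%:~R * (P + (m * k)%:~R * S).
    have e : (m%:~R ^+ 2 = 1 :> R) by rewrite -rmorphXn /= m1.
    split=> //; rewrite [RHS]mulrDr intrM; congr (_ + _).
    by rewrite mulrA (mulrA m%:~R) -expr2 e mul1r.
  rewrite mR' exprMn mR !mul1r.
  have := half_int_dist P S kappa n (m * k) S_gt0 k0 hP.
  set W := (P + _) ^+ 2 => hW.
  have h3 : (1 / 4) * S ^+ 2 + N2 ^+ 2 * (4 * D ^+ 2 - 1) / 4 >= S * N2.
    (* 4 times the difference of the sides exceeds (4 N2 - S)(N2^2 - S^2) / S,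
       because 4 D^2 - 1 >= (4 N2 - S) / S *)
    rewrite -(ler_pM2r S_gt0).
    have := mulr_ge0 (sqr_ge0 N2) (_ : 0 <= D ^+ 2 * S - N2); rewrite subr_ge0 => /(_ ND).
    have : 0 <= (4 * N2 - S) * ((N2 - S) * (N2 + S)) by rewrite !mulr_ge0//; lra.
    by nra.
  have : kappa * S ^+ 2 <= kappa * (S * N2).
    by rewrite ler_wpM2l// expr2 ler_pM2l.
  by lra.
have m4 : 4 <= (m%:~R ^+ 2 : R) by rewrite -rmorphXn /= (ler_int R 4).
have dn : 0 <= A * C * d ^+ 2 by rewrite mulr_ge0 ?sqr_ge0// mulr_ge0// ltW.
have := sqr_ge0 (m%:~R * P + k%:~R * S).
have : 3 * N2 ^+ 2 <= N2 ^+ 2 * (4 * D ^+ 2 - 1).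
  by rewrite mulrC ler_wpM2l ?sqr_ge0//; nra.
have : 4 * (A * C * d ^+ 2) <= A * C * (m%:~R ^+ 2 * d ^+ 2).
  have -> : A * C * (m%:~R ^+ 2 * d ^+ 2) = m%:~R ^+ 2 * (A * C * d ^+ 2) by ring.
  by rewrite ler_wpM2r.
have : 0 <= kappa * (S * N2) := mulr_ge0 k0 (mulr_ge0 (ltW S_gt0) (sqr_ge0 _)).
have := sqr_ge0 N2.
by lra.
Qed.

(** These are the largeness conditions on the coefficient [a] of [v_1]. [T] is the height [q3] at
    which [q3 |q2 w / q3|^2] would equal [rho]. It grows at least quadratically in [a], whereas the
    later adjustment of [b] changes the height by at most about [q2 (6 a + 1)], a small fraction of
    [T]. The last two bounds keep the move of the parameter below [delta]. *)
Lemma next_vector_bounds (x0 y0 x1 y1 q2 kappa delta : R) :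
  1 <= q2 -> x0 * y1 - y0 * x1 != 0 -> 0 < kappa -> 0 < delta ->
  \forall a \near +oo,
  let w := x0 + a * x1 in let w' := y0 + a * y1 in
  let W := A * w ^+ 2 + C * w' ^+ 2 in let V := A * x1 * w + C * y1 * w' in
  let T := q2 ^+ 2 * nrm w w' ^+ 2 / rho in
  [/\ 1 <= a, [/\ 0 < W, 0 < V, V / W <= kappa & W / V <= 6 * a],
      q2 <= T, 1 + q2 * (6 * a + 1) <= kappa * T &
      rho <= T * (A * delta ^+ 2) /\ rho <= T * (C * delta ^+ 2)].
Proof.
move=> q21 det0 k0 d0.
pose al := A * x1 ^+ 2 + C * y1 ^+ 2.
pose be := A * x0 * x1 + C * y0 * y1.
pose ga := A * x0 ^+ 2 + C * y0 ^+ 2.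
have al0 : 0 < al.
  have [x1e|x1n] := eqVneq x1 0.
    have y1n : y1 != 0 by apply: contra_neq det0 => ->; rewrite x1e !mulr0 subrr.
    apply: ltr_wpDl; first by rewrite mulr_ge0 ?sqr_ge0// ltW.
    by rewrite mulr_gt0// lt0r sqrf_eq0 y1n sqr_ge0.
  apply: ltr_pwDl; last by rewrite mulr_ge0 ?sqr_ge0// ltW.
  by rewrite mulr_gt0// lt0r sqrf_eq0 x1n sqr_ge0.
pose tau := q2 ^+ 2 * al / (4 * rho).
have q20 : 0 < q2 := lt_le_trans ltr01 q21.
have tau0 : 0 < tau by rewrite divr_gt0 ?mulr_gt0// exprn_gt0.
have kt0 : 0 < kappa * tau by rewrite mulr_gt0.
have td0 c : 0 < c -> 0 < tau * (c * delta ^+ 2).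
  by move=> c0; rewrite mulr_gt0// mulr_gt0// exprn_gt0.
near=> a.
set w := x0 + a * x1; set w' := y0 + a * y1.
set W := A * w ^+ 2 + _; set V := A * x1 * w + _; set T := _ / rho => /=.
have a1 : 1 <= a by near: a; exact: nbhs_pinfty_ge.
have a0 : 0 < a := lt_le_trans ltr01 a1.
have hbe : 2 * `|be| <= a * al.
  by rewrite -ler_pdivrMr//; near: a; exact: nbhs_pinfty_ge.
have hga : ga <= a * al by rewrite -ler_pdivrMr//; near: a; exact: nbhs_pinfty_ge.
have hk : 2 <= a * kappa by rewrite -ler_pdivrMr//; near: a; exact: nbhs_pinfty_ge.
have hkt : 1 + 7 * q2 <= a * (kappa * tau).
  by rewrite -ler_pdivrMr//; near: a; exact: nbhs_pinfty_ge.
have hq2 : q2 <= a * tau by rewrite -ler_pdivrMr//; near: a; exact: nbhs_pinfty_ge.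
have hA : rho <= a * (tau * (A * delta ^+ 2)).
  by rewrite -ler_pdivrMr ?td0//; near: a; exact: nbhs_pinfty_ge.
have hC : rho <= a * (tau * (C * delta ^+ 2)).
  by rewrite -ler_pdivrMr ?td0//; near: a; exact: nbhs_pinfty_ge.
have VE : V = be + a * al by rewrite /V /be /al /w /w'; ring.
have WE : W = ga + 2 * a * be + a ^+ 2 * al by rewrite /W /ga /be /al /w /w'; ring.
have VW : V ^+ 2 <= al * W.
  rewrite -subr_ge0 (_ : _ - _ = A * C * (x1 * w' - y1 * w) ^+ 2).
    by apply: mulr_ge0 (sqr_ge0 _); exact/ltW/mulr_gt0.
  by rewrite /al /W /V; ring.
have [V0 W0 VWa WVa Wlb] := quadratic_growth al be ga a V W a1 al0 hbe hga VE WE VW.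
have Tlb : tau * a ^+ 2 <= T.
  rewrite /tau /T ler_pdivlMr//.
  rewrite [leLHS](_ : _ = q2 ^+ 2 * (a ^+ 2 * al / 4)); last by field; rewrite gt_eqF.
  rewrite ler_pM2l ?exprn_gt0//; apply: le_trans (nrm_lb _ _).
  by rewrite ler_pdivrMr// [leRHS]mulrC.
have Tlb' : a * tau <= T.
  by apply: le_trans Tlb; rewrite mulrC ler_pM2l// ler_eXnr.
have TM c : 0 <= c -> a * (tau * c) <= T * c.
  by move=> cp; rewrite mulrA ler_wpM2r.
split => //.
- split=> //; apply: (le_trans VWa).
  by rewrite ler_pdivrMr// mulrC.
- exact: le_trans hq2 Tlb'.
- apply: (@le_trans _ _ (kappa * (tau * a ^+ 2))); last by rewrite ler_pM2l.
  apply: (@le_trans _ _ (a * (1 + 7 * q2))); last first.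
    rewrite (_ : kappa * _ = a * (a * (kappa * tau))); last by ring.
    by rewrite ler_pM2l.
  rewrite -subr_ge0 (_ : _ - _ = (a - 1) * (1 + q2)); last by ring.
  by rewrite mulr_ge0 ?subr_ge0// addr_ge0// ltW.
- split; first by apply: (le_trans hA); apply: TM; rewrite mulr_ge0 ?sqr_ge0// ltW.
  by apply: (le_trans hC); apply: TM; rewrite mulr_ge0 ?sqr_ge0// ltW.
Unshelve. all: by end_near.
Qed.

(* (x_i, y_i) is the projection of v_i at the current parameter theta, where
   v_2 projects to 0. The new parameter, at which v_0 + a v_1 + b v_2 projects
   to 0, is theta + (u, u'); there v_1 and v_2 project to x_1 + q_1 u and
   q_2 u. *)
Lemma next_vector (x0 y0 x1 y1 q0 q1 q2 kappa delta : R) :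
  0 <= q0 -> 0 <= q1 -> 1 <= q2 -> x0 * y1 - y0 * x1 != 0 ->
  0 < kappa <= 1 -> 0 < delta ->
  exists a b n : int,
  let q3 := q0 + a%:~R * q1 + b%:~R * q2 in
  let u := - (x0 + a%:~R * x1) / q3 in let u' := - (y0 + a%:~R * y1) / q3 in
  let S := A * (q2 * u) ^+ 2 + C * (q2 * u') ^+ 2 in
  [/\ [/\ q2 + 1 <= q3, `|u| <= delta & `|u'| <= delta],
      (q3 + 1) * nrm (q2 * u) (q2 * u') ^+ 2 < rho,
      (1 - kappa) * rho <= q3 * nrm (q2 * u) (q2 * u') ^+ 2,
      0 < nrm (q2 * u) (q2 * u') &
      `|(A * (x1 + q1 * u) * (q2 * u) + C * (y1 + q1 * u') * (q2 * u'))
         - (n%:~R + 1 / 2) * S| <= kappa * S].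
Proof.
move=> q00 q10 q21 det0 k01 d0.
have /andP[k0 k1] := k01.
have [M [_ hM]] := next_vector_bounds _ _ _ _ _ _ _ q21 det0 k0 d0.
have /hM : M < (Num.ceil M + 1)%:~R by rewrite intrD ltr_pwDr// ceil_ge.
set ai := Num.ceil M + 1; set a : R := ai%:~R.
move=> /=; set w := x0 + a * x1; set w' := y0 + a * y1.
set W := A * w ^+ 2 + C * w' ^+ 2; set V := A * x1 * w + C * y1 * w'.
set T := q2 ^+ 2 * nrm w w' ^+ 2 / rho.
move=> [a1 [W0 V0 VW WV] Tq2 Tk [TA TC]].
have q20 : 0 < q2 by lra.
have s0 : 0 < V / W by rewrite divr_gt0.
(* The ratio [P / S] below is affine in [b] with slope [- V / W], so a suitable [b] puts it near a
   half-integer. The lower bound on [b] says [q3 >= T + 1]. *)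
have [b [n [b1 b2 hbn]]] := int_near_half (V / W) ((q1 - (q0 + a * q1) * (V / W)) / q2)
   ((T + 1 - q0 - a * q1) / q2) s0.
exists ai, b, n => /=; rewrite -/a -/w -/w'.
set q3 := q0 + a * q1 + b%:~R * q2.
have q3T : T + 1 <= q3 by move: b1; rewrite ler_pdivrMr// /q3; lra.
have q3u : q3 <= (1 + kappa) * T.
  have : b%:~R * q2 <= T + 1 - q0 - a * q1 + 6 * a * q2 + q2.
    rewrite -ler_pdivlMr//; apply: (le_trans b2).
    rewrite invf_div [leRHS](_ : _ = (T + 1 - q0 - a * q1) / q2 + 6 * a + 1); first by lra.
    by field; rewrite gt_eqF.
  by rewrite /q3; lra.
have q30 : 0 < q3 by lra.
have q3n : q3 != 0 by rewrite gt_eqF.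
have T0 : 0 < T by lra.
have nE : nrm (q2 * (- w / q3)) (q2 * (- w' / q3)) ^+ 2 = rho * T / q3 ^+ 2.
  have -> : q2 * (- w / q3) = (- q2 / q3) * w by ring.
  have -> : q2 * (- w' / q3) = (- q2 / q3) * w' by ring.
  rewrite nrmZ exprMn real_normK ?num_real// /T.
  by field; rewrite q3n gt_eqF.
have d2 (X c : R) : 0 < c -> c * X ^+ 2 <= W -> rho <= T * (c * delta ^+ 2) -> `|- X / q3| <= delta.
  move=> c0 h1 h2.
  rewrite normrM normrN normfV (gtr0_norm q30) ler_pdivrMr//.
  rewrite -ler_sqr ?nnegrE ?mulr_ge0 ?(ltW d0) ?(ltW q30)// real_normK ?num_real//.
  rewrite -(ler_pM2l c0); apply: (le_trans h1).
  apply: (@le_trans _ _ (T * rho)).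
    apply: (le_trans (nrm_lb _ _)).
    rewrite /T divfK ?gt_eqF// ler_peMl ?sqr_ge0//.
    by rewrite expr2; nra.
  apply: (@le_trans _ _ (T * (T * (c * delta ^+ 2)))); first by rewrite ler_pM2l.
  have -> : T * (T * (c * delta ^+ 2)) = c * (delta * T) ^+ 2 by ring.
  have dT : 0 <= delta * T := mulr_ge0 (ltW d0) (ltW T0).
  have dq : 0 <= delta * q3 := mulr_ge0 (ltW d0) (ltW q30).
  rewrite ler_pM2l// ler_sqr ?nnegrE//.
  by rewrite ler_pM2l//; lra.
rewrite nE; split.
- split; first by lra.
  + apply: (d2 _ A) => //; rewrite /W lerDl mulr_ge0 ?sqr_ge0// ltW//.
  + apply: (d2 _ C) => //; rewrite /W lerDr mulr_ge0 ?sqr_ge0// ltW//.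
(* From [q3 >= T + 1] follows [(q3 + 1) T <= q3^2 - 1], which makes room for the extra unit. *)
- rewrite mulrA ltr_pdivrMr ?exprn_gt0//.
  have -> : (q3 + 1) * (rho * T) = rho * ((q3 + 1) * T) by ring.
  by rewrite ltr_pM2l//; nra.
- have -> : q3 * (rho * T / q3 ^+ 2) = rho * (T / q3) by field.
  rewrite mulrC ler_pM2l// ler_pdivlMr//; nra.
- rewrite lt0r nrm_ge0 andbT -sqrf_eq0 nE.
  by rewrite gt_eqF//; apply: divr_gt0; [exact: mulr_gt0 | exact: exprn_gt0].
set S := A * _ ^+ 2 + _.
have SE : S = q2 ^+ 2 / q3 ^+ 2 * W by rewrite /S /W; field.
have S0 : 0 < S by rewrite SE; apply: mulr_gt0 => //; apply: divr_gt0; exact: exprn_gt0.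
set P := A * (x1 + _) * _ + _.
have PE : P = S * ((q1 - (q0 + a * q1) * (V / W)) / q2 - V / W * b%:~R).
  have bE : b%:~R = (q3 - q0 - a * q1) / q2 by rewrite /q3; field; rewrite gt_eqF.
  have -> : P = - (q2 / q3) * V + q1 * q2 / q3 ^+ 2 * W by rewrite /P /V /W; field.
  by rewrite SE bE; field; rewrite q3n !gt_eqF.
rewrite PE (mulrC _ S) -mulrBr normrM (gtr0_norm S0) [leRHS]mulrC ler_pM2l//.
exact: le_trans VW.
Qed.
End PlaneNorm.

(** * Nested stages and the limit point *)

Definition ivec : Type := (int * int * int)%type.

Definition ivec_det (u v w : ivec) : int :=
  u.1.1 * (v.1.2 * w.2 - v.2 * w.1.2) - u.1.2 * (v.1.1 * w.2 - v.2 * w.1.1)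
  + u.2 * (v.1.1 * w.1.2 - v.1.2 * w.1.1).

Lemma ivec_cramer (u v w z : ivec) : ivec_det u v w = 1 ->
  let i := ivec_det z v w in let j := ivec_det u z w in let k := ivec_det u v z in
  [/\ z.1.1 = i * u.1.1 + j * v.1.1 + k * w.1.1,
      z.1.2 = i * u.1.2 + j * v.1.2 + k * w.1.2 &
      z.2 = i * u.2 + j * v.2 + k * w.2].
Proof.
move=> d1 /=; rewrite -[z.1.1]mul1r -[z.1.2]mul1r -[z.2]mul1r -d1 /ivec_det.
by split; ring.
Qed.

Definition horx {R : realType} (t : R * R) (z : ivec) : R := z.1.1%:~R + z.2%:~R * t.1.
Definition hory {R : realType} (t : R * R) (z : ivec) : R := z.1.2%:~R + z.2%:~R * t.2.

Record stage (R : realType) := Stage { sv0 : ivec; sv1 : ivec; sv2 : ivec; rad : R }.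
Arguments sv0 {R}.
Arguments sv1 {R}.
Arguments sv2 {R}.
Arguments rad {R}.

(* The parameter at which [sv2 s] projects to 0. *)
Definition center {R : realType} (s : stage R) : R * R :=
  (- (sv2 s).1.1%:~R / (sv2 s).2%:~R, - (sv2 s).1.2%:~R / (sv2 s).2%:~R).

Definition box {R : realType} (s : stage R) (t : R * R) : Prop :=
  `|t.1 - (center s).1| <= rad s /\ `|t.2 - (center s).2| <= rad s.

Definition stage_ok {R : realType} (s : stage R) : Prop :=
  [/\ ivec_det (sv0 s) (sv1 s) (sv2 s) = 1, 0 <= (sv0 s).2, 0 <= (sv1 s).2,
      1 <= (sv2 s).2 & 0 < rad s].

Lemma box_sub (R : realType) (s s' : stage R) : 0 < rad s' ->
  (forall t, box s' t -> box s t) ->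
  let c := center s in let c' := center s' in
  [/\ c.1 - rad s <= c'.1 - rad s', c'.1 + rad s' <= c.1 + rad s,
      c.2 - rad s <= c'.2 - rad s' & c'.2 + rad s' <= c.2 + rad s].
Proof.
move=> d0 sub c c'.
have bb (x y : R) : `|x| = rad s' -> `|y| = rad s' -> box s' (c'.1 + x, c'.2 + y).
  by move=> hx hy; split=> /=; rewrite addrAC subrr add0r (hx, hy).
have nn : `|- rad s'| = rad s' by rewrite normrN gtr0_norm.
have [] := sub _ (bb _ _ (gtr0_norm d0) (gtr0_norm d0)).
have [] := sub _ (bb _ _ nn nn); rewrite /= -/c !ler_norml.
by move=> /andP[? ?] /andP[? ?] /andP[? ?] /andP[? ?]; split; lra.
Qed.

Section Stages.
Context {R : realType} (nrm : R -> R -> R) (A C D r : R).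
Hypothesis nrmD : forall x y x' y', nrm (x + x') (y + y') <= nrm x y + nrm x' y'.
Hypothesis nrmZ : forall k x y, nrm (k * x) (k * y) = `|k| * nrm x y.
Hypothesis nrm_ge0 : forall x y, 0 <= nrm x y.
Hypothesis A_gt0 : 0 < A.
Hypothesis C_gt0 : 0 < C.
Hypothesis nrm_lb : forall x y, A * x ^+ 2 + C * y ^+ 2 <= nrm x y ^+ 2.
Hypothesis nrm_ub : forall x y, nrm x y ^+ 2 <= D ^+ 2 * (A * x ^+ 2 + C * y ^+ 2).
Hypothesis r_gt0 : 0 < r.
Hypothesis r_le : (r ^+ 3) ^+ 2 * (4 * D ^+ 2 - 1) <= 4 * A * C.

(* For E = e^s this says c <= lambda_1(g_s L_(t,0)). *)
Definition tall_short (t : R * R) (c E : R) : Prop := forall z : ivec,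
  z <> (0, 0, 0) -> c <= E * nrm (horx t z) (hory t z) \/ c * E ^+ 2 <= `|z.2%:~R|.

Lemma tall_short_le (t : R * R) c c' E :
  c <= c' -> tall_short t c' E -> tall_short t c E.
Proof.
move=> cc h z /h[h1|h1]; [left|right]; first exact: le_trans h1.
by apply: le_trans h1; rewrite ler_wpM2r// sqr_ge0.
Qed.

(** The conditions on [t] hold on the whole new box, so they pass to the limit parameter. The third
    clause bounds the local maxima of [lambda_1], with a spare unit that later absorbs the shear;
    the fourth gives a time at which [lambda_1] is nearly [r], and [q' <= r E^2] sends these times
    to infinity. *)
Definition next_stage (s s' : stage R) : Prop :=
  let q := (sv2 s).2%:~R : R in let q' := (sv2 s').2%:~R : R in
  [/\ q + 1 <= q',
      forall t, box s' t -> box s t,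
      forall t, box s' t -> (q' + 1) * nrm (horx t (sv2 s)) (hory t (sv2 s)) ^+ 2 < r ^+ 3 &
      exists E, [/\ 0 < E, q' <= r * E ^+ 2 &
        forall t, box s' t -> tall_short t ((1 - 3 / q) * r) E]].

Lemma nrm_axes_le x y e : `|x| <= e -> `|y| <= e -> nrm x y <= e * (nrm 1 0 + nrm 0 1).
Proof.
move=> hx hy; rewrite mulrDr.
have -> : nrm x y = nrm (x * 1 + y * 0) (x * 0 + y * 1).
  by congr nrm; ring.
apply: (le_trans (nrmD _ _ _ _)); rewrite !nrmZ.
by apply: lerD; apply: ler_wpM2r.
Qed.

(** Apply [next_vector] at the center with [kappa = 1/q2], pass to the basis [v_1, v_2, v_3], and
    shrink the box until the estimates survive. The factor [1 - 3/q] collects three losses of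
    [kappa]: in the comparison with the shortest vector, in the lower bound for [q3 N^2], and in
    moving the parameter. *)
Lemma next_stage_exists (s : stage R) : stage_ok s ->
  exists s', stage_ok s' /\ next_stage s s'.
Proof.
case: s => [[[p0 p0'] q0] [[p1 p1'] q1] [[p2 p2'] q2] rd] [/= det1 q00 q10 q21 rd0].
set Q0 : R := q0%:~R; set Q1 : R := q1%:~R; set Q2 : R := q2%:~R.
have Q00 : 0 <= Q0 by rewrite ler0z.
have Q10 : 0 <= Q1 by rewrite ler0z.
have Q21 : 1 <= Q2 by rewrite (@ler_int R 1).
have Q20 : Q2 != 0 by rewrite gt_eqF//; lra.
pose t1 : R := - p2%:~R / Q2; pose t2 : R := - p2'%:~R / Q2.
pose x0 := p0%:~R + Q0 * t1; pose y0 := p0'%:~R + Q0 * t2.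
pose x1 := p1%:~R + Q1 * t1; pose y1 := p1'%:~R + Q1 * t2.
have detR : (ivec_det (p0, p0', q0) (p1, p1', q1) (p2, p2', q2))%:~R = 1 :> R by rewrite det1.
have det0 : x0 * y1 - y0 * x1 != 0.
  have -> : x0 * y1 - y0 * x1 = Q2^-1; last by rewrite invr_eq0.
  apply: (mulfI Q20); rewrite mulfV// -detR /ivec_det /=.
  rewrite !(intrD, intrB, intrN, intrM) -/Q0 -/Q1 -/Q2.
  by rewrite /x0 /x1 /y0 /y1 /t1 /t2; field.
have k01 : 0 < Q2^-1 <= 1.
  by rewrite invr_gt0 invf_le1 ?Q21 ?andbT; lra.
have rd2 : 0 < rd / 2 by lra.
have r30 : 0 < r ^+ 3 by rewrite exprn_gt0.
have [a [b [n]]] := next_vector nrm A C (r ^+ 3) nrmZ nrm_ge0 A_gt0 C_gt0 nrm_lb r30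
  x0 y0 x1 y1 Q0 Q1 Q2 Q2^-1 (rd / 2) Q00 Q10 Q21 det0 k01 rd2.
set kap := Q2^-1 in k01 *; have /andP[k0 k1] := k01.
cbv zeta; set Q3 := Q0 + _ + _; set u := - (x0 + _) / Q3; set u' := - (y0 + _) / Q3.
set S := A * _ ^+ 2 + _; set N := nrm (Q2 * u) _.
move=> [[Q3Q2 ud ud'] up low N0 half].
pose p3 := p0 + a * p1 + b * p2; pose p3' := p0' + a * p1' + b * p2'.
pose q3 := q0 + a * q1 + b * q2.
have Q3E : q3%:~R = Q3 by rewrite /q3 !(intrD, intrM).
have Q20' : 0 < Q2 := lt_le_trans ltr01 Q21.
have Q23 : Q2 <= Q3 by apply: le_trans Q3Q2; rewrite lerDl.
have Q30 : 0 < Q3 := lt_le_trans Q20' Q23.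
have Q3n : Q3 != 0 by rewrite gt_eqF.
have cx : - p3%:~R / Q3 = t1 + u.
  apply: (mulIf Q3n); rewrite divfK// mulrDl /u divfK// /p3 !(intrD, intrM) /x0 /x1 /Q3 /t1 -/Q0 -/Q1 -/Q2.
  by field.
have cy : - p3'%:~R / Q3 = t2 + u'.
  apply: (mulIf Q3n); rewrite divfK// mulrDl /u' divfK// /p3' !(intrD, intrM) /y0 /y1 /Q3 /t2 -/Q0 -/Q1 -/Q2.
  by field.
have X2 : p2%:~R + Q2 * (t1 + u) = Q2 * u by rewrite /t1; field.
have Y2 : p2'%:~R + Q2 * (t2 + u') = Q2 * u' by rewrite /t2; field.
have det3 : ivec_det (p1, p1', q1) (p2, p2', q2) (p3, p3', q3) = 1.
  by rewrite -[RHS]det1 /ivec_det /= /p3 /p3' /q3; ring.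
clearbody p3 p3' q3.
pose K := nrm 1 0 + nrm 0 1 + 1.
have K0 : 0 < K by rewrite ltr_wpDl// addr_ge0.
have KQ : 0 < Q3 * K by rewrite mulr_gt0.
have Q31 : 0 < Q3 + 1 by rewrite addr_gt0.
have [e e0 he] : exists2 e, 0 < e & (N + e) ^+ 2 < N ^+ 2 + (r ^+ 3 / (Q3 + 1) - N ^+ 2).
  by apply: sqr_close; rewrite ?ltW// subr_gt0 ltr_pdivlMr// mulrC.
(* Moving the parameter by [rd'] displaces the projection of a vector of height at most [Q3] by at
   most [Q3 K rd']. The term [e] preserves the strict upper bound, [kap N] the lower bound, and
   [rd / 2] the inclusion of boxes. *)
pose rd' := Num.min (rd / 2) (Num.min e (kap * N) / (Q3 * K)).
have kN : 0 < kap * N by rewrite mulr_gt0.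
have rd'0 : 0 < rd' by rewrite lt_min rd2 divr_gt0// lt_min e0.
have rd'1 : rd' <= rd / 2 by rewrite ge_min lexx.
have rd'2 : Q3 * K * rd' <= Num.min e (kap * N).
  rewrite mulrC -ler_pdivlMr//; by rewrite ge_min lexx orbT.
have rd'e : Q3 * K * rd' <= e by apply: (le_trans rd'2); rewrite ge_min lexx.
have rd'k : Q3 * K * rd' <= kap * N by apply: (le_trans rd'2); rewrite ge_min lexx orbT.
pose s' := @Stage R (p1, p1', q1) (p2, p2', q2) (p3, p3', q3) rd'.
have cs' : center s' = (t1 + u, t2 + u') by rewrite /center /= Q3E cx cy.
have move_le (t : R * R) (z : ivec) : box s' t -> `|z.2%:~R| <= Q3 ->
    nrm (horx t z - horx (t1 + u, t2 + u') z) (hory t z - hory (t1 + u, t2 + u') z) <= Q3 * K * rd'.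
  rewrite /box cs' /= => -[h1 h2] hz.
  have -> : horx t z - horx (t1 + u, t2 + u') z = z.2%:~R * (t.1 - (t1 + u)).
    by rewrite /horx /=; ring.
  have -> : hory t z - hory (t1 + u, t2 + u') z = z.2%:~R * (t.2 - (t2 + u')).
    by rewrite /hory /=; ring.
  rewrite nrmZ -mulrA; apply: ler_pM => //.
  apply: (le_trans (nrm_axes_le _ _ _ h1 h2)); rewrite mulrC ler_pM2r//.
  by rewrite /K lerDl.
have tri (x y x' y' : R) : nrm x y <= nrm x' y' + nrm (x - x') (y - y').
  by rewrite -[in leLHS](subrKC x' x) -[in leLHS](subrKC y' y).
have symN (x y : R) : nrm (- x) (- y) = nrm x y.
  by rewrite -mulN1r -(mulN1r y) nrmZ normrN1 mul1r.
have q31 : 1 <= q3 by rewrite -(@ler_int R) Q3E; exact: le_trans Q23.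
exists s'; split; first by split=> //=; exact: le_trans q21.
rewrite /next_stage /= Q3E -/Q2; split => //.
- move=> t; rewrite /box cs' /= /center /= -/Q2 -/t1 -/t2 => -[h1 h2]; split.
    have -> : t.1 - t1 = (t.1 - (t1 + u)) + u by ring.
    by rewrite [rd]splitr; apply: (le_trans (ler_normD _ _)); apply: lerD => //; exact: le_trans rd'1.
  have -> : t.2 - t2 = (t.2 - (t2 + u')) + u' by ring.
  by rewrite [rd]splitr; apply: (le_trans (ler_normD _ _)); apply: lerD => //; exact: le_trans rd'1.
- move=> t bt.
  have hle : nrm (horx t (p2, p2', q2)) (hory t (p2, p2', q2)) <= N + e.
    apply: (le_trans (tri _ _ (horx (t1 + u, t2 + u') (p2, p2', q2)) (hory (t1 + u, t2 + u') (p2, p2', q2)))).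
    rewrite {1}/horx {1}/hory /= -/Q2 X2 Y2 lerD2l.
    apply: le_trans rd'e; apply: move_le => //=.
    by rewrite -/Q2 gtr0_norm.
  rewrite mulrC -ltr_pdivlMr//.
  apply: (@le_lt_trans _ _ ((N + e) ^+ 2)); last by rewrite subrKC in he.
  by rewrite ler_sqr ?nnegrE// addr_ge0// ltW.
have upN : Q3 * N ^+ 2 <= r ^+ 3.
  by apply: le_trans (ltW up); rewrite ler_wpM2r ?sqr_ge0// lerDl.
have [E [E0 EN EN1 EN2]] := time_scale Q3 N kap r Q30 N0 k01 r_gt0 low upN.
exists E; split=> //.
  by rewrite -EN mulrC ler_wpM2r// sqr_ge0.
move=> t bt [[z1 z2] z3] zn.
have [hz|hz] := lerP Q3 `|z3%:~R|.
  right => /=; apply: le_trans hz; rewrite -EN mulrC ler_wpM2l ?sqr_ge0//.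
  apply: le_trans EN2.
  by rewrite ler_pM2r// -/kap lerD2l lerN2 ler_peMl ?ler1n// ltW.
left.
pose z : ivec := (z1, z2, z3).
pose i := ivec_det z (p2, p2', q2) (p3, p3', q3).
pose j := ivec_det (p1, p1', q1) z (p3, p3', q3).
pose k := ivec_det (p1, p1', q1) (p2, p2', q2) z.
have [zE1 zE2 zE3] := ivec_cramer _ _ _ z det3; rewrite /= -/i -/j -/k in zE1 zE2 zE3.
clearbody i j k.
(* A multiple of [v_3] of height below [q3] is zero, so [z] has a component along [v_1] or [v_2]. *)
have ij : (i != 0) || (j != 0).
  rewrite -negb_and; apply/negP => /andP[/eqP i0 /eqP j0].
  move: zE1 zE2 zE3; rewrite i0 j0 !mul0r !add0r => zE1 zE2 zE3.
  have [k00|k0n] := eqVneq k 0.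
    by apply: zn; rewrite zE1 zE2 zE3 k00 !mul0r.
  move: hz; rewrite zE3 intrM normrM Q3E (gtr0_norm Q30).
  by rewrite ltNge ler_peMl ?(ltW Q30)// normr_intr_ge1.
have detq : (Q3 * ((x1 + Q1 * u) * (Q2 * u') - (y1 + Q1 * u') * (Q2 * u))) ^+ 2 = 1.
  have -> : Q3 * ((x1 + Q1 * u) * (Q2 * u') - (y1 + Q1 * u') * (Q2 * u)) = 1; last by rewrite expr1n.
  rewrite -[1]/(1%:~R) -det3 /ivec_det /=.
  rewrite !(intrD, intrB, intrN, intrM) Q3E -/Q1 -/Q2.
  have -> : p3%:~R = - Q3 * (t1 + u) by rewrite -cx mulNr mulrC divfK// opprK.
  have -> : p3'%:~R = - Q3 * (t2 + u') by rewrite -cy mulNr mulrC divfK// opprK.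
  by rewrite /x1 /y1 /t1 /t2; field.
have := short_vector_dominates nrm A C D (r ^+ 3) nrmZ A_gt0 C_gt0 nrm_lb nrm_ub r30 r_le
  (Q2 * u) (Q2 * u') (x1 + Q1 * u) (y1 + Q1 * u') Q3 kap n Q30 detq upN.
rewrite (ltW k0) k1 => /(_ isT half i j ij); rewrite -/N => dom.
have hx : horx (t1 + u, t2 + u') z = i%:~R * (x1 + Q1 * u) + j%:~R * (Q2 * u).
  rewrite /horx /= zE1 zE3 !intrD !intrM Q3E -/Q1 -/Q2.
  have -> : p3%:~R = - Q3 * (t1 + u) by rewrite -cx mulNr mulrC divfK// opprK.
  by rewrite -X2 /x1; ring.
have hy : hory (t1 + u, t2 + u') z = i%:~R * (y1 + Q1 * u') + j%:~R * (Q2 * u').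
  rewrite /hory /= zE2 zE3 !intrD !intrM Q3E -/Q1 -/Q2.
  have -> : p3'%:~R = - Q3 * (t2 + u') by rewrite -cy mulNr mulrC divfK// opprK.
  by rewrite -Y2 /y1; ring.
rewrite -hx -hy in dom.
set H := nrm (horx _ z) _ in dom.
have H1 : (1 - kap) * N <= H.
  have [kk|kk] := lerP (1 - kap) 0.
    by apply: le_trans (nrm_ge0 _ _); rewrite pmulr_lle0.
  rewrite -ler_sqr ?nnegrE ?nrm_ge0//; last exact: ltW (mulr_gt0 kk N0).
  apply: le_trans dom; rewrite exprMn ler_pM2r ?exprn_gt0//.
  by rewrite expr2 ler_piMr ?(ltW kk)// gerBl ltW.
have H2 : (1 - 2 * kap) * N <= nrm (horx t z) (hory t z).
  have := tri (horx (t1 + u, t2 + u') z) (hory (t1 + u, t2 + u') z) (horx t z) (hory t z).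
  rewrite -/H -(symN (_ - _)) !opprB => h.
  rewrite (_ : _ * N = (1 - kap) * N - kap * N); last by ring.
  rewrite lerBlDr; apply: (le_trans H1); apply: (le_trans h).
  by rewrite lerD2l; exact: le_trans (move_le t z bt (ltW hz)) rd'k.
(* The losses combine by [(1 - 2 kap) (1 - kap) >= 1 - 3 kap]. *)
have [kk|kk] := lerP (1 - 2 * kap) 0.
  apply: (@le_trans _ _ 0); last by rewrite mulr_ge0 ?(ltW E0).
  by rewrite pmulr_lle0// -/kap; apply: le_trans kk; rewrite lerD2l lerN2 ler_pM2r// ler_nat.
apply: (@le_trans _ _ ((1 - 2 * kap) * (E * N))); last first.
  by rewrite mulrCA ler_pM2l.
apply: (@le_trans _ _ ((1 - 2 * kap) * ((1 - kap) * r))); last by rewrite ler_pM2l.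
rewrite mulrA ler_pM2r// -/kap -subr_ge0 (_ : _ - _ = 2 * kap ^+ 2); last by ring.
by rewrite mulr_ge0 ?sqr_ge0.
Qed.

(** Iterating the step from the standard basis gives nested boxes; a common point inherits the
    estimates of all stages. *)
Lemma limit_point : exists (t : R * R) (v : nat -> ivec),
  [/\ forall k, k.+1%:R <= (v k).2%:~R :> R,
      forall k, ((v k.+1).2%:~R + 1) * nrm (horx t (v k)) (hory t (v k)) ^+ 2 < r ^+ 3 &
      forall c M, c < r -> exists E, [/\ M <= E, 0 < E & tall_short t c E]].
Proof.
have /choice[f hf] : forall s : stage R, exists s', stage_ok s -> stage_ok s' /\ next_stage s s'.
  move=> s; have [ok|nok] := pselect (stage_ok s); last by exists s.
  by have [s' hs'] := next_stage_exists s ok; exists s'.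
pose s0 := @Stage R (1, 0, 0) (0, 1, 0) (0, 0, 1) 1.
pose s k := iter k f s0.
have ok k : stage_ok (s k).
  by elim: k => [|k IH] /=; [split | have [] := hf _ IH].
have next k : next_stage (s k) (s k.+1) by have [] := hf _ (ok k).
have rad0 k : 0 < rad (s k) by case: (ok k).
have bs k := box_sub _ _ _ (rad0 k.+1) (let: And4 _ h _ _ := next k in h).
have [t1 ht1] : exists t, forall k, `|t - (center (s k)).1| <= rad (s k).
  by apply: nested_intervals => k; [exact: ltW | have [] := bs k | have [] := bs k].
have [t2 ht2] : exists t, forall k, `|t - (center (s k)).2| <= rad (s k).
  by apply: nested_intervals => k; [exact: ltW | have [] := bs k | have [] := bs k].
have bt k : box (s k) (t1, t2) by split; [exact: ht1 | exact: ht2].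
have qk k : k.+1%:R <= (sv2 (s k)).2%:~R :> R.
  elim: k => [|k IH] //; case: (next k) => h _ _ _.
  by apply: le_trans h; rewrite -natr1 lerD2r.
exists (t1, t2), (fun k => sv2 (s k)); split => //.
  by move=> k; case: (next k) => _ _ h _; exact: h (bt _).
move=> c M cr.
(* The first summand gives [3 r / q <= r - c], the second [M <= E] through
   [r M^2 <= q' <= r E^2]. *)
pose k := `|Num.ceil (3 * r / (r - c) + r * M ^+ 2)|%N.
have kge : 3 * r / (r - c) + r * M ^+ 2 <= k.+1%:R.
  apply: (le_trans (ceil_ge _)); rewrite -[k.+1%:R]natr1 /k natr_absz.
  by rewrite (le_trans (ler_norm _))// intr_norm lerDl.
have rc : 0 < r - c by rewrite subr_gt0.
have r3 : 0 < 3 * r / (r - c) by rewrite divr_gt0// mulr_gt0.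
have rM : 0 <= r * M ^+ 2 by rewrite mulr_ge0 ?sqr_ge0// ltW.
have q0 : 0 < (sv2 (s k)).2%:~R :> R by apply: lt_le_trans (qk k); rewrite ltr0n.
case: (next k) => _ _ _ [E [E0 EE ts]]; exists E; split => //.
  have [M0|M0] := lerP M 0; first by apply: (le_trans M0); exact: ltW.
  rewrite -ler_sqr ?nnegrE ?(ltW M0) ?(ltW E0)// -(ler_pM2l r_gt0).
  apply: le_trans EE; apply: le_trans (qk k.+1); rewrite -[k.+2%:R]natr1; lra.
apply: tall_short_le (ts _ (bt _)).
set q := (sv2 (s k)).2%:~R in q0 *.
have : 3 * r / q <= r - c.
  rewrite ler_pdivrMr// [leRHS]mulrC -ler_pdivrMr//; have := qk k; rewrite -/q; lra.
have -> : (1 - 3 / q) * r = r - 3 * r / q by ring.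
lra.
Qed.

End Stages.

(** * Lattices *)

Section SpaceVectors.
Context {R : realType}.

Definition cv2 (x y : R) : 'cV[R]_2 := \col_i [:: x; y]`_i.
Definition cv3 (x y z : R) : 'cV[R]_3 := \col_i [:: x; y; z]`_i.
Definition cvz (z : ivec) : 'cV[int]_3 := \col_i [:: z.1.1; z.1.2; z.2]`_i.

Lemma cv3_inj x y z x' y' z' : cv3 x y z = cv3 x' y' z' -> [/\ x = x', y = y' & z = z'].
Proof.
move=> e; have h i := congr1 (fun M : 'cV[R]_3 => M i 0) e.
have := h 0; have := h 1; have := h ord_max.
by rewrite !mxE /=.
Qed.

Lemma cvzK (v : 'cV[int]_3) : v = cvz (v 0 0, v 1 0, v ord_max 0).
Proof.
apply/colP => i; rewrite mxE; case: i => [[|[|[|//]]] hi] /=.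
- by congr (v _ _); apply: val_inj.
- by congr (v _ _); apply: val_inj.
- by congr (v _ _); apply: val_inj.
Qed.

Lemma mulmx_cvz (A : 'M[R]_3) (z : ivec) : A *m map_mx intr (cvz z) =
  cv3 (A 0 0 * z.1.1%:~R + A 0 1 * z.1.2%:~R + A 0 ord_max * z.2%:~R)
      (A 1 0 * z.1.1%:~R + A 1 1 * z.1.2%:~R + A 1 ord_max * z.2%:~R)
      (A ord_max 0 * z.1.1%:~R + A ord_max 1 * z.1.2%:~R + A ord_max ord_max * z.2%:~R).
Proof.
apply/colP => i; rewrite !mxE !big_ord_recr big_ord0 /= add0r !mxE /=.
have -> : widen_ord (leqnSn 2) (widen_ord (leqnSn 1) ord_max) = 0 :> 'I_3 by apply: val_inj.
have -> : widen_ord (leqnSn 2) ord_max = 1 :> 'I_3 by apply: val_inj.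
case: i => [[|[|[|//]]] hi] /=.
- by have -> : Ordinal hi = 0 by apply: val_inj.
- by have -> : Ordinal hi = 1 by apply: val_inj.
- by have -> : Ordinal hi = ord_max by apply: val_inj.
Qed.

Lemma mul_g_cv3 (t x y z : R) :
  g_ t *m cv3 x y z = cv3 (expR t * x) (expR t * y) (expR (- 2 * t) * z).
Proof.
rewrite /g_ mul_diag_mx; apply/colP => i; rewrite !mxE.
by case: i => [[|[|[|//]]] hi].
Qed.

Lemma det_g (t : R) : \det (g_ t) = 1.
Proof.
rewrite /g_ det_diag !big_ord_recr big_ord0 /= !mxE /= mul1r.
by rewrite -!expRD [X in expR X](_ : _ = 0) ?expR0//; ring.
Qed.

Lemma g_act_lattice_of (t : R) (A : 'M[R]_3) :
  g_act t (lattice_of A) = lattice_of (g_ t *m A).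
Proof.
rewrite /g_act /lattice_of; apply/seteqP; split => [_ [_ [z _ <-] <-]|_ [z _ <-]].
  by exists z => //; rewrite mulmxA.
by exists (A *m map_mx intr z); [exists z | rewrite mulmxA].
Qed.

Lemma X3_g_act (t : R) (L : set 'cV[R]_3) : X3 L -> X3 (g_act t L).
Proof.
move=> [A A1 ->]; exists (g_ t *m A); last exact: g_act_lattice_of.
by rewrite det_mulmx det_g mul1r.
Qed.

Variable N : 'cV[R]_2 -> R.
Hypothesis hN : is_norm N.

Definition plane_norm (x y : R) : R := N (cv2 x y).

Lemma norm0 : N 0 = 0.
Proof. by rewrite -(scale0r (0 : 'cV[R]_2)) (norm_homogeneous hN) normr0 mul0r. Qed.

Lemma plane_norm_ge0 x y : 0 <= plane_norm x y.
Proof.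
have := norm_triangle hN (cv2 x y) (- cv2 x y).
by rewrite subrr norm0 -scaleN1r (norm_homogeneous hN) normrN1 /plane_norm; lra.
Qed.

Lemma plane_norm_le_add x y x' y' :
  plane_norm (x + x') (y + y') <= plane_norm x y + plane_norm x' y'.
Proof.
rewrite /plane_norm (_ : cv2 (x + x') _ = cv2 x y + cv2 x' y').
  exact: (norm_triangle hN).
by apply/colP => i; rewrite !mxE; case: i => [[|[|//]] hi].
Qed.

Lemma plane_normZ k x y : plane_norm (k * x) (k * y) = `|k| * plane_norm x y.
Proof.
rewrite /plane_norm (_ : cv2 (k * x) _ = k *: cv2 x y) ?(norm_homogeneous hN)//.
by apply/colP => i; rewrite !mxE; case: i => [[|[|//]] hi].
Qed.

Lemma norm_star_cv3 x y z : norm_star N (cv3 x y z) = Num.max (plane_norm x y) `|z|.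
Proof.
rewrite /plane_norm /norm_star mxE /=; congr (Num.max (N _) _).
by apply/colP => i; rewrite !mxE; case: i => [[|[|//]] hi].
Qed.

Lemma norm_star_ge0 u : 0 <= norm_star N u.
Proof. by rewrite /norm_star le_max normr_ge0 orbT. Qed.

Lemma lambda1_le (L : set 'cV[R]_3) u : L u -> u <> 0 -> lambda1 N L <= norm_star N u.
Proof.
move=> Lu u0; apply: ge_inf; last by exists u.
by exists 0 => _ [v _ <-]; exact: norm_star_ge0.
Qed.

End SpaceVectors.

(** * Sheared lattices over a fixed parameter and their escape levels *)

Section TiltedLattices.
Context {R : realType}.

(** The third row is [(0, 0, 1)] plus [w] times the first row: this is the shear. *)
Definition tilt_mx (t : R * R) (w : R) : 'M[R]_3 := \matrix_(i, j)
  nth 0 (nth [::] [:: [:: 1; 0; t.1]; [:: 0; 1; t.2]; [:: w; 0; 1 + w * t.1]] i) j.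

Lemma det_tilt_mx t w : \det (tilt_mx t w) = 1.
Proof.
rewrite (expand_det_row _ 0) !big_ord_recl big_ord0 /cofactor.
rewrite !(expand_det_row _ 0) !big_ord_recl !big_ord0 /cofactor !det_mx11 !mxE /=.
by rewrite /bump /=; ring.
Qed.

Definition tilted (t : R * R) (w : R) : set 'cV[R]_3 := lattice_of (tilt_mx t w).

Lemma X3_tilted t w : X3 (tilted t w).
Proof. by exists (tilt_mx t w) => //; rewrite det_tilt_mx normr1. Qed.

Lemma tilt_mx_cvz t w z : tilt_mx t w *m map_mx intr (cvz z) =
  cv3 (horx t z) (hory t z) (z.2%:~R + w * horx t z).
Proof. by rewrite mulmx_cvz !mxE /=; congr cv3; rewrite /horx /hory; ring. Qed.

Lemma tilted_mem t w z : tilted t w (cv3 (horx t z) (hory t z) (z.2%:~R + w * horx t z)).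
Proof. by exists (cvz z) => //; rewrite tilt_mx_cvz. Qed.

Lemma tilted_inv t w u : tilted t w u ->
  exists z, u = cv3 (horx t z) (hory t z) (z.2%:~R + w * horx t z).
Proof.
by move=> [v _ <-]; rewrite (cvzK v); eexists; rewrite tilt_mx_cvz.
Qed.

Lemma cv3_0 : cv3 0 0 0 = 0 :> 'cV[R]_3.
Proof. by apply/colP => i; rewrite !mxE; case: i => [[|[|[|//]]] hi]. Qed.

Context (N : 'cV[R]_2 -> R) (hN : is_norm N).
Local Notation nrm := (plane_norm N).

Lemma lambda1_tilted_lt t w z c s :
  z.2 <> 0 -> expR s * nrm (horx t z) (hory t z) < c ->
  expR (- 2 * s) * `|z.2%:~R + w * horx t z| < c ->
  lambda1 N (g_act s (tilted t w)) < c.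
Proof.
move=> z0 h1 h2.
pose u := cv3 (horx t z) (hory t z) (z.2%:~R + w * horx t z).
have := lambda1_le N (g_act s (tilted t w)) (g_ s *m u); rewrite mul_g_cv3 norm_star_cv3 => H.
apply: le_lt_trans (H _ _) _.
- by exists u; [exact: tilted_mem | rewrite mul_g_cv3].
(* If the first coordinate vanishes, so does the shear term, and the third becomes a nonzero
   multiple of [z.2]. *)
- rewrite -cv3_0 => /cv3_inj[/eqP]; rewrite mulf_eq0 gt_eqF ?expR_gt0//= => /eqP x0 _ /eqP.
  rewrite mulf_eq0 gt_eqF ?expR_gt0//= x0 mulr0 addr0 intr_eq0 => /eqP; exact: z0.
rewrite gt_max normrM (gtr0_norm (expR_gt0 _)) h2 andbT.
by rewrite (plane_normZ N hN) (gtr0_norm (expR_gt0 _)).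
Qed.

Lemma lambda1_tilted_ge t w c s :
  (forall z, z <> (0, 0, 0) -> c <= expR s * nrm (horx t z) (hory t z) \/
     c <= expR (- 2 * s) * `|z.2%:~R + w * horx t z|) ->
  c <= lambda1 N (g_act s (tilted t w)).
Proof.
move=> H; apply: lb_le_inf.
  pose z : ivec := (0, 0, 1).
  exists (norm_star N (g_ s *m cv3 (horx t z) (hory t z) (z.2%:~R + w * horx t z))).
  exists (g_ s *m cv3 (horx t z) (hory t z) (z.2%:~R + w * horx t z)) => //; split.
    by eexists; [exact: tilted_mem|].
  rewrite mul_g_cv3 -cv3_0 => /cv3_inj[/eqP]; rewrite mulf_eq0 gt_eqF ?expR_gt0//= => /eqP x0 _ /eqP.
  by rewrite mulf_eq0 gt_eqF ?expR_gt0//= x0 mulr0 addr0 oner_eq0.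
move=> _ [u [[v /tilted_inv[z ->] <-] u0] <-].
rewrite mul_g_cv3 norm_star_cv3 le_max normrM (gtr0_norm (expR_gt0 _)).
rewrite (plane_normZ N hN) (gtr0_norm (expR_gt0 _)).
apply/orP; apply: H => z0; apply: u0.
by rewrite z0 /horx /hory /= !mul0r !addr0 mulr0 addr0 mul_g_cv3 !mulr0 cv3_0.
Qed.

Lemma expRN2 s : expR (- 2 * s) = (expR s ^+ 2)^-1 :> R.
Proof. by rewrite mulNr expRN -expRM_natl mulrC. Qed.

Context (r : R) (r_gt0 : 0 < r) (t : R * R).
Hypothesis t_tall : forall c M, c < r ->
  exists E, [/\ M <= E, 0 < E & tall_short nrm t c E].

(* Otherwise L would contain a nonzero vertical vector, which g_t contracts. *)
Lemma tilted_inj : injective (tilted t).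
Proof.
move=> w w' ww'.
pose e1 : ivec := (1, 0, 0).
have := tilted_mem t w e1; rewrite ww' => /tilted_inv[z /cv3_inj[hx hy hz]].
have [ze|zn] := pselect (z = e1).
  by move: hz; rewrite ze => /addrI/mulIf; apply; rewrite /horx /= mul0r addr0 oner_neq0.
(* The nonzero vector [z - e1] projects to 0, so it would have to be tall, which the lower bound on
   [E] excludes. *)
have r2 : r / 2 < r by have := r_gt0; lra.
have [E [ME E0 ts]] := t_tall (r / 2) (1 + 2 * `|z.2%:~R| / r) r2.
case: (ts (z.1.1 - 1, z.1.2, z.2)) => /=.
- move=> [a b c]; apply: zn; rewrite [z]surjective_pairing [z.1]surjective_pairing b c.
  by rewrite (_ : z.1.1 = 1)//; lia.
- rewrite /horx /hory /= in hx hy *.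
  rewrite (_ : _ + _ = 0); last by rewrite intrB; lra.
  rewrite (_ : z.1.2%:~R + _ = 0); last by lra.
  have -> : nrm 0 0 = 0 by rewrite -[X in nrm X _](mul0r 0) -[X in nrm _ X](mul0r 0) plane_normZ// normr0 mul0r.
  by rewrite mulr0; lra.
move=> h; exfalso.
have q0 : 0 <= `|z.2%:~R : R| by [].
have E1 : 1 <= E.
  by apply: le_trans ME; rewrite lerDl divr_ge0 ?mulr_ge0// ltW.
have : E <= E ^+ 2 by rewrite expr2 ler_peMr// ltW.
have : 2 * `|z.2%:~R| / r < E by lra.
rewrite ltr_pdivrMr//; nra.
Qed.

Context (A : R) (A_gt0 : 0 < A).
Hypothesis N_lb : forall x y, A * x ^+ 2 <= nrm x y ^+ 2.

Lemma tilt_bound w : exists2 B, 0 <= B & forall x y, `|w * x| <= B * nrm x y.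
Proof.
have sA : 0 < Num.sqrt A by rewrite sqrtr_gt0.
exists (`|w| / Num.sqrt A); first by rewrite divr_ge0// ltW.
move=> x y; rewrite normrM -mulrA; apply: ler_wpM2l => //.
rewrite mulrC ler_pdivlMr//.
rewrite -ler_sqr ?nnegrE ?plane_norm_ge0// ?mulr_ge0// ?(ltW sA)//.
by rewrite exprMn sqr_sqrtr ?(ltW A_gt0)// real_normK ?num_real// mulrC.
Qed.

(** If [e < r], take [c] midway. At arbitrarily late times a vector of stretched horizontal length
    below [e] has height at least [c E^2] and shear term at most [c - e], whence [lambda_1 >= e]. *)
Lemma escape_tilted_ge w e : escape_levels N (tilted t w) e -> r <= e.
Proof.
move=> [e0 [M [_ hM]]]; rewrite leNgt; apply/negP => er.
have [B B0 hB] := tilt_bound w.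
pose c := (e + r) / 2.
have cr : c < r by rewrite /c; lra.
have ec : 0 < c - e by rewrite /c; lra.
have Bec : 0 <= B * e / (c - e) by rewrite divr_ge0 ?mulr_ge0// ltW.
(* The summands provide [1 <= E], [M < ln E] and [B e / E <= c - e]. *)
have [E [ME E0 ts]] := t_tall c (1 + expR M + B * e / (c - e)) cr.
have eM := expR_gt0 M.
have sE : expR (ln E) = E by rewrite lnK.
have Ms : M < ln E by rewrite -ltr_expR sE; lra.
apply: (hM _ Ms); split; first exact/X3_g_act/X3_tilted.
apply: lambda1_tilted_ge => z z0; rewrite expRN2 sE.
have [h|h] := lerP e (E * nrm (horx t z) (hory t z)); [by left | right].
case: (ts z z0) => [h'|h']; first by lra.
rewrite mulrC ler_pdivlMr ?exprn_gt0//.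
set n := nrm _ _ in h *; have n0 : 0 <= n by exact: plane_norm_ge0.
have h1 : `|w * horx t z| <= B * n by exact: hB.
have h2 : E * (B * n) <= B * e by rewrite mulrCA; apply: ler_wpM2l => //; exact: ltW.
have h3 : B * e <= (c - e) * E by rewrite [leRHS]mulrC -ler_pdivrMr//; lra.
have h4 : B * n <= c - e.
  by rewrite -(ler_pM2l E0) (mulrC E (c - e)); exact: le_trans h3.
have h5 : c - e <= (c - e) * E ^+ 2.
  rewrite ler_peMr ?(ltW ec)// exprn_ege1//; lra.
have := lerB_normD z.2%:~R (w * horx t z); lra.
Qed.

Context (v : nat -> ivec).
Hypothesis v_height : forall k, k.+1%:R <= (v k).2%:~R :> R.
Hypothesis v_short : forall k,
  ((v k.+1).2%:~R + 1) * nrm (horx t (v k)) (hory t (v k)) ^+ 2 < r ^+ 3.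

(** At each late time the short vector is [v_k] for the least [k] with [r E^2 <= q_(k+1) + 1]: this
    inequality controls the stretched projection, and minimality of [k] the contracted height. *)
Lemma escape_tilted w : escape_levels N (tilted t w) r.
Proof.
split=> //.
have [B B0 hB] := tilt_bound w.
(* The summands ensure [E >= 1], a shear term at most 1, and [q_0 + 1 < r E^2], which replaces
   minimality when [k = 0]. *)
pose M := 1 + B * r + ((v 0).2%:~R + 1) / r.
exists (ln M); split; first exact: num_real.
move=> s Ms [_]; apply/negP; rewrite -ltNge.
have q0 k : 0 < (v k).2%:~R :> R by apply: lt_le_trans (v_height k); rewrite ltr0n.
have Br : 0 <= B * r by rewrite mulr_ge0// ltW.
have v0r : 0 <= ((v 0).2%:~R + 1) / r by rewrite divr_ge0 ?(ltW r_gt0)// addr_ge0// ltW.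
have M0 : 0 < M by rewrite /M; lra.
set E := expR s; have E0 : 0 < E by exact: expR_gt0.
have ME : M < E by rewrite -[M]lnK ?posrE// ltr_expR.
have E1 : 1 <= E by rewrite /M in ME; lra.
have EE : E <= E ^+ 2 by rewrite expr2 ler_peMr// ltW.
have ex : exists k, r * E ^+ 2 <= (v k.+1).2%:~R + 1.
  exists (`|Num.ceil (r * E ^+ 2)|)%N.
  apply: (le_trans (ceil_ge _)).
  set n := Num.ceil _; have := v_height `|n|%N.+1; rewrite -!natr1 natr_absz.
  by have := ler_norm (n%:~R : R); rewrite -intr_norm; lra.
have [k hk mink] := ex_minnP ex.
set n := nrm (horx t (v k)) (hory t (v k)).
have n0 : 0 <= n by exact: plane_norm_ge0.
have rE0 : 0 < r * E ^+ 2 by rewrite mulr_gt0// exprn_gt0.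
have nE : E * n < r.
  rewrite -ltr_sqr ?nnegrE ?(ltW r_gt0)// ?mulr_ge0// ?(ltW E0)//.
  rewrite exprMn -(ltr_pM2l r_gt0) -exprS mulrA.
  apply: le_lt_trans (v_short k); rewrite -/n ler_wpM2r ?sqr_ge0//.
have nw : B * n <= 1.
  have : E * (B * n) <= B * r by rewrite mulrCA; apply: ler_wpM2l => //; exact: ltW.
  move=> h; rewrite -(ler_pM2l E0) mulr1; rewrite /M in ME; lra.
have qk : (v k).2%:~R + 1 < r * E ^+ 2.
  case: k hk mink {n n0 nE nw} => [|k] hk mink.
    have : ((v 0).2%:~R + 1) / r < E by rewrite /M in ME; lra.
    by rewrite ltr_pdivrMr// mulrC => h; apply: (lt_le_trans h); rewrite ler_pM2l.
  rewrite ltNge; apply/negP => /mink; by rewrite ltnn.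
apply: (lambda1_tilted_lt t w (v k)) => //.
  by move=> z0; have := q0 k; rewrite z0 ltxx.
rewrite expRN2 mulrC ltr_pdivrMr ?exprn_gt0//; apply: le_lt_trans qk.
apply: (le_trans (ler_normD _ _)); rewrite gtr0_norm// lerD2l.
exact: le_trans (hB _ _) nw.
Qed.

End TiltedLattices.

(** * Lattices with a vertical vector, for [r = 0] *)

Section DivergentLattices.
Context {R : realType} (N : 'cV[R]_2 -> R) (hN : is_norm N).

Definition stretch_mx (s : R) : 'M[R]_3 := diag_mx (\row_j [:: expR s; expR (- s); 1]`_j).

Lemma stretch_mx_cvz s z : stretch_mx s *m map_mx intr (cvz z) =
  cv3 (expR s * z.1.1%:~R) (expR (- s) * z.1.2%:~R) z.2%:~R.
Proof.
rewrite /stretch_mx mul_diag_mx; apply/colP => i; rewrite !mxE.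
by case: i => [[|[|[|//]]] hi] //=; rewrite mul1r.
Qed.

Lemma X3_stretch s : X3 (lattice_of (stretch_mx s)).
Proof.
exists (stretch_mx s) => //; rewrite det_diag !big_ord_recr big_ord0 /= !mxE /=.
by rewrite mul1r mulr1 -expRD subrr expR0 normr1.
Qed.

(** Equality of the lattices makes [expR s] a positive integer multiple of [expR s'], so [s' <= s];
    symmetry concludes. *)
Lemma stretch_inj : injective (fun s => lattice_of (stretch_mx s)).
Proof.
have le s s' : lattice_of (stretch_mx s) = lattice_of (stretch_mx s') -> s' <= s.
  move=> e.
  have : lattice_of (stretch_mx s) (stretch_mx s *m map_mx intr (cvz (1, 0, 0))) by exists (cvz (1, 0, 0)).
  rewrite e => -[z _]; rewrite (cvzK z) !stretch_mx_cvz => /cv3_inj[/= h _ _].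
  rewrite mulr1 in h; set m := z 0 0 in h.
  have m0 : (0 < m).
    rewrite -(ltr0z R) -(pmulr_rgt0 _ (expR_gt0 s')) h; exact: expR_gt0.
  have m1 : 1 <= m%:~R :> R by rewrite (@ler_int R 1).
  by rewrite -ler_expR -h ler_peMr// ltW// expR_gt0.
by move=> s s' e; apply/eqP; rewrite eq_le !le//.
Qed.

Lemma escape_stretch s e : 0 < e -> escape_levels N (lattice_of (stretch_mx s)) e.
Proof.
move=> e0; split=> //; exists (- ln e / 2); split; first exact: num_real.
move=> t ht [_]; apply/negP; rewrite -ltNge.
pose u := g_ t *m (stretch_mx s *m map_mx intr (cvz (0, 0, 1))).
have uE : u = cv3 0 0 (expR (- 2 * t)).
  by rewrite /u stretch_mx_cvz mul_g_cv3 /= !mulr0 mulr1.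
apply: (@le_lt_trans _ _ (norm_star N u)).
  apply: lambda1_le; last by rewrite uE -cv3_0 => /cv3_inj[_ _ /eqP]; rewrite gt_eqF ?expR_gt0.
  by eexists; [exists (cvz (0, 0, 1))|].
rewrite uE norm_star_cv3 -[X in plane_norm _ X _](mul0r 0) -[X in plane_norm _ _ X](mul0r 0).
rewrite plane_normZ// normr0 mul0r gt_max e0 gtr0_norm ?expR_gt0//=.
by rewrite -[e]lnK ?posrE// ltr_expR; lra.
Qed.

End DivergentLattices.

(** * Cardinality *)

Lemma card_le_inj (T U : Type) (A : set T) (B : set U) (f : T -> U) :
  (forall x, A x -> B (f x)) -> {in A &, injective f} -> (A #<= B)%card.
Proof.
move=> AB finj; apply: (card_le_trans (B := f @` A)).
  by have := inj_card_eq finj; rewrite card_eq_sym => /card_eqPle[].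
by apply: subset_card_le => _ [x Ax <-]; exact: AB.
Qed.

Section CantorReal.
Context {R : realType}.
Implicit Type b : nat -> bool.

(** Base 3 with digits 0 and 1 only, so that expansions are unique. *)
Definition ternary_sum b (n : nat) : R := \sum_(i < n) (b i)%:R / 3 ^+ i.

Lemma ternary_sumS b n : ternary_sum b n.+1 = ternary_sum b n + (b n)%:R / 3 ^+ n.
Proof. by rewrite /ternary_sum big_ord_recr. Qed.

Lemma ternary_sum_mono b m n : (m <= n)%N -> ternary_sum b m <= ternary_sum b n.
Proof.
move/subnK => <-; elim: (n - m)%N => [|k IH] //=.
rewrite addSn ternary_sumS; apply: (le_trans IH).
by rewrite lerDl divr_ge0// exprn_ge0.
Qed.

(** The increment of the bound is the exact geometric sum; its subtracted term lets the induction
    close. *)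
Lemma ternary_sum_tail b m k :
  ternary_sum b (m + k) <= ternary_sum b m + 3 / 2 / 3 ^+ m - 3 / 2 / 3 ^+ (m + k).
Proof.
elim: k => [|k IH]; first by rewrite addn0 addrK.
rewrite addnS ternary_sumS; apply: (le_trans (lerD IH (lexx _))).
rewrite exprSr; set x := 3 ^+ (m + k); have x1 : 0 < x by exact: exprn_gt0.
have x0 : 0 < x^-1 by rewrite invr_gt0.
have xn : x != 0 by rewrite gt_eqF.
have -> : 3 / 2 / (x * 3) = x^-1 / 2 by field.
have : (b (m + k)%N)%:R / x <= x^-1 by case: (b _); rewrite ?mul1r ?mul0r// ltW.
lra.
Qed.

Lemma ternary_sum_le b m n : ternary_sum b n <= ternary_sum b m + 3 / 2 / 3 ^+ m.
Proof.
apply: (le_trans (ternary_sum_mono b _ _ (leq_addl m n))).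
apply: (le_trans (ternary_sum_tail b m n)).
by rewrite gerBl divr_ge0// exprn_ge0.
Qed.

Definition ternary b : R := sup (range (ternary_sum b)).

Lemma ternary_ge b n : ternary_sum b n <= ternary b.
Proof.
apply: ub_le_sup; last by exists n.
by exists (ternary_sum b 0 + 3 / 2 / 3 ^+ 0) => _ [k _ <-]; exact: ternary_sum_le.
Qed.

Lemma ternary_le b n : ternary b <= ternary_sum b n + 3 / 2 / 3 ^+ n.
Proof.
apply: ge_sup; first by exists (ternary_sum b 0); exists 0%N.
by move=> _ [k _ <-]; exact: ternary_sum_le.
Qed.

(** The first differing digit [m] contributes [3^(-m)], all later ones together at most half of
    that. *)
Lemma ternary_inj : injective ternary.
Proof.
move=> b b' E; apply/funext => n; apply: contrapT => /eqP ne.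
have [m nem minm] := ex_minnP (ex_intro (fun n => b n != b' n) n ne).
wlog bm : b b' E {ne} nem minm / b m.
  move=> H; have [bm|nbm] := boolP (b m); first exact: (H b b').
  apply: (H b' b) => //; first by rewrite eq_sym.
    by move=> k; rewrite eq_sym; exact: minm.
  by move: nem; rewrite (negbTE nbm); case: (b' m).
have b'm : b' m = false by move: nem; rewrite bm; case: (b' m).
have eqm : ternary_sum b m = ternary_sum b' m.
  apply: eq_bigr => i _; suff -> : b i = b' i by [].
  by apply/eqP; apply: contraT => /minm; rewrite leqNgt ltn_ord.
have := ternary_ge b m.+1; have := ternary_le b' m.+1.
rewrite E !ternary_sumS eqm bm b'm mul0r addr0 mul1r exprSr.
set x := 3 ^+ m; have x1 : 0 < x by exact: exprn_gt0.
have x0 : 0 < x^-1 by rewrite invr_gt0.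
have xn : x != 0 by rewrite gt_eqF.
have -> : 3 / 2 / (x * 3) = x^-1 / 2 by field.
lra.
Qed.

End CantorReal.

(** Subsets of a countable type become binary sequences through [pickle], then reals; indices that
    decode to nothing get [false]. *)
Lemma card_le_realsetnat (R : realType) (T : countType) (U : Type) (f : U -> T -> bool) :
  injective f -> ([set: U] #<= [set: R])%card.
Proof.
move=> finj.
pose g (u : U) : nat -> bool := fun n => if unpickle n is Some x then f u x else false.
apply: (card_le_inj _ _ _ _ (fun u => ternary (g u))) => // u v _ _ /ternary_inj guv.
apply: finj; apply/funext => x.
by have := congr1 (@^~ (pickle x)) guv; rewrite /g pickleK.
Qed.

(** A matrix is determined by the rational cuts of its entries. *)
Lemma card_matrix_le (R : realType) (m n : nat) : ([set: 'M[R]_(m, n)] #<= [set: R])%card.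
Proof.
apply: (card_le_realsetnat R ('I_m * 'I_n * rat)%type _
  (fun (A : 'M[R]_(m, n)) x => ratr x.2 < A x.1.1 x.1.2)) => A B AB.
apply/matrixP => i j.
have cut (M N : 'M[R]_(m, n)) : (forall q : rat, ratr q < M i j -> ratr q < N i j) -> M i j <= N i j.
  move=> H; rewrite leNgt; apply/negP => /rat_in_itvoo[q].
  by rewrite in_itv /= => /andP[Nq /H]; rewrite ltNge (ltW Nq).
have ABq q : (ratr q < A i j) = (ratr q < B i j) by have := congr1 (@^~ (i, j, q)) AB.
by apply/eqP; rewrite eq_le !cut// => q; rewrite ABq.
Qed.

Lemma card_X3_le (R : realType) : (@X3 R #<= [set: R])%card.
Proof.
apply: (card_le_trans _ (card_matrix_le R 3 3)).
apply: (card_le_trans _ (card_image_le (@lattice_of R) [set: 'M[R]_3])).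
by apply: subset_card_le => _ [A _ ->]; exists A.
Qed.

(** * The theorem *)

Section EllipsoidBounds.
Context {R : realType} (N : 'cV[R]_2 -> R) (hN : is_norm N) (a c D : R).
Hypothesis hb : ellipsoid_bound N a c D.

Lemma ellipsoid_normE x y : ellipsoid_norm a c (cv2 x y) ^+ 2 = a * x ^+ 2 + c * y ^+ 2.
Proof.
have [a0 c0 _ _] := hb; rewrite sqr_sqrtr; first by rewrite !mxE.
by rewrite addr_ge0// mulr_ge0 ?sqr_ge0// ltW.
Qed.

Lemma plane_norm_lb x y : a * x ^+ 2 + c * y ^+ 2 <= plane_norm N x y ^+ 2.
Proof.
have [_ _ _ /(_ (cv2 x y))/andP[h _]] := hb; rewrite -ellipsoid_normE.
by rewrite ler_sqr// nnegrE ?sqrtr_ge0 ?plane_norm_ge0.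
Qed.

Lemma plane_norm_ub x y : plane_norm N x y ^+ 2 <= D ^+ 2 * (a * x ^+ 2 + c * y ^+ 2).
Proof.
have [_ _ D1 /(_ (cv2 x y))/andP[_ h]] := hb; rewrite -ellipsoid_normE -exprMn.
rewrite ler_sqr// nnegrE ?plane_norm_ge0// mulr_ge0 ?sqrtr_ge0//.
exact: le_trans D1.
Qed.

(** Raise to the sixth power: [1/4 * 2/3 * 6 = 1]. The result is the hypothesis [rho_le] for
    [rho = r^3]. *)
Lemma ellipsoid_value_pow r : 0 <= r -> r <= ellipsoid_value a c D `^ (2 / 3) ->
  (r ^+ 3) ^+ 2 * (4 * D ^+ 2 - 1) <= 4 * a * c.
Proof.
have [a0 c0 D1 _] := hb.
have D2 : 0 < 4 * D ^+ 2 - 1 by nra.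
have X0 : 0 <= 4 * a * c / (4 * D ^+ 2 - 1) by rewrite divr_ge0 ?(ltW D2)// !mulr_ge0// ltW.
move=> r0; rewrite /ellipsoid_value -powRrM => h.
rewrite -ler_pdivlMr// -exprM.
have : r ^+ 6 <= ((4 * a * c / (4 * D ^+ 2 - 1)) `^ (1 / 4 * (2 / 3))) ^+ 6.
  by rewrite ler_pXn2r ?nnegrE ?powR_ge0.
rewrite -powR_mulrn ?powR_ge0// -powRrM [X in _ `^ X](_ : _ = 1) ?powRr1//.
by field.
Qed.
End EllipsoidBounds.

Theorem corollary3 (R : realType) (N : 'cV[R]_2 -> R) (hN : is_norm N)
    (a c D : R) (hbest : best_ellipsoid N a c D)
    (r : R) (hr : 0 <= r <= ellipsoid_value a c D `^ (2 / 3)) :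
  ([set L : set 'cV[R]_3 | X3 L /\ is_min_pos (escape_levels N L) r]
    #= [set: R])%card.
Proof.
have [hb _] := hbest; move: hr => /andP[r0 hr].
apply/card_eqPle; split.
  apply: (card_le_trans _ (card_X3_le R)).
  by apply: subset_card_le => L [].
move: r0; rewrite le_eqVlt => /predU1P[r0|r0].
  apply: (card_le_inj _ _ _ _ (fun s => lattice_of (stretch_mx s))); last first.
    by move=> s s' _ _ /stretch_inj.
  move=> s _; split; first exact: X3_stretch.
  right; split=> //; apply/seteqP; split=> [e []//|e e0].
  exact: escape_stretch.
have [a0 c0 _ _] := hb.
have lb := plane_norm_lb N hN a c D hb.
have lbx x y : a * x ^+ 2 <= plane_norm N x y ^+ 2.
  by apply: le_trans (lb x y); rewrite lerDl mulr_ge0 ?sqr_ge0// ltW.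
have [t [v [vh vs vt]]] := limit_point (plane_norm N) a c D r (plane_norm_le_add N hN)
  (plane_normZ N hN) (plane_norm_ge0 N hN) a0 c0 lb
  (plane_norm_ub N hN a c D hb) r0
  (ellipsoid_value_pow N a c D hb r (ltW r0) hr).
(* One parameter [t] suffices; the shear [w] supplies the continuum. *)
apply: (card_le_inj _ _ _ _ (tilted t)); last by move=> w w' _ _ /(tilted_inj N hN r r0 t vt).
move=> w _; split; first exact: X3_tilted.
left; split; first exact: (escape_tilted N hN r r0 t a a0 lbx v vh vs).
by move=> e; exact: (escape_tilted_ge N hN r t vt a a0 lbx).
Qed.
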